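(* In the setting below (Algorithm 1), (i) truthful reporting is a Nash equilibrium: for every agent $i\in[m]$ and every strategy $f_i$, $$\mathbb E\big[L_i(\mathrm{id},\dots,\mathrm{id})\big]\le \mathbb E\big[L_i(f_i,(\mathrm{id})_{j\neq i})\big].$$ (ii) If moreover $\Pi$ is not degenerate, then ''more data is strictly better'': when all agents are truthful, for every agent $i$, every choice of sample sizes $(n_j)_{j\ne i}$ and all $n_i<n_i'$, the expected loss of agent $i$ when holding (and truthfully submitting) $n_i'$ points is strictly smaller than when holding $n_i$ points, the other agents' sample sizes being unchanged.
   Context: Setting (Algorithm 1). Fix $m\ge 2$ agents. A prior $\Pi$ is a probability distribution on the set of Borel probability distributions on $\mathbb{R}$. A random distribution $D\sim\Pi$ is drawn; conditionally on $D$, agent $i\in[m]$ holds a dataset $X_i=(X_{i,1},\dots,X_{i,n_i})$ whose entries are i.i.d. from $D$, independent across agents (one may regard $X_{i,1},X_{i,2},\dots$ as an infinite conditionally i.i.d. sequence of which the agent holds the first $n_i$). A strategy is a measurable map $f:\bigcup_{\ell\ge0}\mathbb{R}^\ell\to\bigcup_{\ell\ge0}\mathbb{R}^\ell$; agent $i$ submits $X_i'=f_i(X_i)$; the truthful strategy $\mathrm{id}$ is the identity. For a finite nonempty multiset $S\subset\mathbb R$ let $F_S(t)=\frac1{|S|}\sum_{s\in S}\mathbf 1\{s\le t\}$. For integers $k\ge0,r\ge1$ let $h_{k,r}:\mathbb R^{k+1}\to[0,1]$ be measurable such that whenever $D\sim\Pi$ and, conditionally on $D$, $Y_1,\dots,Y_k,T,Z_1,\dots,Z_r$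 are i.i.d. from $D$, one has $h_{k,r}(Y_1,\dots,Y_k,T)=\mathbb E[F_{\{Z_1,\dots,Z_r\}}(T)\mid Y_1,\dots,Y_k,T]$ a.s. Mechanism: for each agent $i$, let $X'_{-i}=\bigcup_{j\ne i}X'_j$ (multiset union, assumed to have at least 2 elements), pick $T_i$ uniformly at random from $X'_{-i}$ independently of everything else, set $Z_i=X'_{-i}\setminus\{T_i\}$, and define the loss $L_i=\big(h_{|X_i'|,|Z_i|}(X_i',T_i)-F_{Z_i}(T_i)\big)^2\in[0,1]$. $L_i(f_1,\dots,f_m)$ denotes the loss when agents use strategies $f_1,\dots,f_m$. Expectations are over $D\sim\Pi$, the data, and all randomness of mechanism and strategies. Degenerate prior: let $D\sim\Pi$ and, conditionally on $D$, $X_1,X_2,\dots,T,Z$ be i.i.d. from $D$. $\Pi$ is degenerate if for some $n\in\mathbb N$, $P(Z\le T\mid T,X_1,\dots,X_n)=P(Z\le T\mid T,X_1,\dots,X_{n+1})$ almost surely. *)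

(* Defs.v *)
From HB Require Import structures.
From mathcomp Require Import all_boot all_order all_algebra.
From mathcomp Require Import all_classical all_reals all_analysis.
Set Implicit Arguments.
Unset Strict Implicit.
Unset Printing Implicit Defensive.
Import Order.TTheory GRing.Theory Num.Theory.
Local Open Scope classical_set_scope.
Local Open Scope ring_scope.

Section Defs.
Variable R : realType.

(** A prior: a probability on the measurable space of Borel probability
    measures on R (sigma-algebra generated by the evaluation maps
    D |-> D U, as in MathComp-Analysis' [pprobability]). *)
Definition prior := probability (pprobability R R) R.

(** Iterated integral of [g] w.r.t. [D^{(x) N}]: the first coordinate of the
    sample is integrated outermost.  [iint D N g] = E[g(X_1,...,X_N)] for
    X_1,...,X_N i.i.d. from D. *)
Fixpoint iint (D : probability R R) (N : nat) (g : seq R -> \bar R) : \bar R :=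
  match N with
  | 0 => g [::]
  | N'.+1 => (\int[D]_x iint D N' (fun s => g (x :: s)))%E
  end.

Definition Exp (Pi : prior) (N : nat) (g : seq R -> \bar R) : \bar R :=
  (\int[Pi]_D iint (D : probability R R) N g)%E.

Definition ecdf (S : seq R) (t : R) : R :=
  (count (fun s => s <= t) S)%:R / (size S)%:R.

Definition tuple_of_seq (n : nat) (s : seq R) : n.-tuple R :=
  [tuple nth 0 s i | i < n].

(** [g] is a version of E[F_{Z_1..Z_r}(T) | Y_1..Y_k, T], where, given D ~ Pi,
    Y_1..Y_k, T, Z_1..Z_r are i.i.d. from D.  The argument of [g] is the
    (k+1)-tuple (Y_1,...,Y_k,T).  This is the defining property of conditional
    expectation: g is measurable and E[1_A(Y,T) g(Y,T)] = E[1_A(Y,T) F_Z(T)]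
    for every measurable A in R^{k+1}. *)
Definition is_cond_ecdf (Pi : prior) (k r : nat) (g : k.+1.-tuple R -> R) : Prop :=
  measurable_fun setT g /\
  forall A : set (k.+1.-tuple R), measurable A ->
    Exp Pi (k.+1 + r)
      (fun s => (\1_A (tuple_of_seq k.+1 s) * g (tuple_of_seq k.+1 s))%:E) =
    Exp Pi (k.+1 + r)
      (fun s => (\1_A (tuple_of_seq k.+1 s) * ecdf (drop k.+1 s) (nth 0 s k))%:E).

Definition valid_h (Pi : prior) (h : forall k r : nat, k.+1.-tuple R -> R) : Prop :=
  forall k r : nat, (1 <= r)%N ->
    (forall x, 0 <= h k r x <= 1) /\ @is_cond_ecdf Pi k r (h k r).

(** Degenerate prior: for some n, P(Z <= T | T, X_1..X_n) = P(Z <= T | T, X_1..X_{n+1})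
    almost surely.  Here versions of these conditional probabilities are
    [g1] (argument (X_1..X_n,T)) and [g2] (argument (X_1..X_{n+1},T));
    the samples are ordered X_1..X_{n+1},T. *)
Definition degenerate (Pi : prior) : Prop :=
  exists (n : nat) (g1 : n.+1.-tuple R -> R) (g2 : n.+2.-tuple R -> R),
    @is_cond_ecdf Pi n 1 g1 /\ @is_cond_ecdf Pi n.+1 1 g2 /\
    Exp Pi n.+2
      (fun s => (\1_[set s' : seq R |
                       g1 (tuple_of_seq n.+1 (rcons (take n s') (nth 0 s' n.+1)))
                       != g2 (tuple_of_seq n.+2 s')] s)%:E) = 0%E.

(** Strategies: maps from finite sequences to finite sequences, measurable
    for the disjoint-union sigma-algebra on \bigcup_l R^l. *)
Definition strategy := seq R -> seq R.

Definition strategy_measurable (f : strategy) : Prop :=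
  forall l l' : nat,
    measurable [set x : l.-tuple R | size (f x) = l'] /\
    forall j : nat,
      measurable_fun [set x : l.-tuple R | size (f x) = l'] (fun x => nth 0 (f x) j).

Definition rem_at (k : nat) (S : seq R) : seq R := take k S ++ drop k.+1 S.

(** Expected loss of agent i (expectation over the mechanism's uniform choice
    of T_i in X'_{-i}) given the submitted datasets X'.  T_i is the element at
    a uniformly random position of the multiset union X'_{-i}, and
    Z_i = X'_{-i} \ {T_i}. *)
Definition mech_loss (m : nat) (h : forall k r : nat, k.+1.-tuple R -> R)
    (X' : 'I_m -> seq R) (i : 'I_m) : R :=
  let S := flatten [seq X' j | j <- enum 'I_m & j != i] in
  (size S)%:R^-1 *
  \sum_(p < size S)
     (h (size (X' i)) (size S).-1
        (tuple_of_seq (size (X' i)).+1 (rcons (X' i) (nth 0 S p)))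
      - ecdf (rem_at p S) (nth 0 S p)) ^+ 2.

Definition exp_loss (Pi : prior) (h : forall k r : nat, k.+1.-tuple R -> R)
    (m : nat) (n : 'I_m -> nat) (fs : 'I_m -> strategy) (i : 'I_m) : \bar R :=
  let ns := [seq n j | j <- enum 'I_m] in
  Exp Pi (sumn ns)
    (fun s => (mech_loss h
                 (fun j => fs j (nth [::] (reshape ns s) (nat_of_ord j))) i)%:E).

Definition deviate (m : nat) (i : 'I_m) (f : strategy) : 'I_m -> strategy :=
  fun j => if j == i then f else id.

Definition upd_size (m : nat) (n : 'I_m -> nat) (i : 'I_m) (ni : nat) : 'I_m -> nat :=
  fun j => if j == i then ni else n j.

End Defs.

(* Main.v *)
Require Import Defs.
From HB Require Import structures.
From mathcomp Require Import all_boot all_order all_algebra.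
From mathcomp Require Import all_classical all_reals all_analysis.
From mathcomp Require Import measurable_realfun giry zify ring lra.
Set Implicit Arguments.
Unset Strict Implicit.
Unset Printing Implicit Defensive.
Import Order.TTheory GRing.Theory Num.Theory.
Local Open Scope classical_set_scope.
Local Open Scope ring_scope.

(** Write k for the number of points the agent holds and r + 1 for the number
    held by the others.  By exchangeability the position of T_i in X'_{-i} is
    irrelevant, so the expected loss of a strategy f is
      E[(h(f(Y), T) - F_Z(T))^2]
    with Y_1..Y_k, T, Z_1..Z_r conditionally i.i.d.  The truthful prediction
    h(Y, T) is the orthogonal projection of F_Z(T) on the functions of (Y, T),
    whence (i) by Pythagoras.  Applied to h(Y_1..Y_k, T), seen as a function of
    (Y_1..Y_{k+1}, T), Pythagoras also shows that one more point decreases the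
    loss by E[(h(Y_1..Y_k, T) - h(Y_1..Y_{k+1}, T))^2]; if this vanished, then
    Pi would be degenerate, since E[F_Z(T) | Y, T] does not depend on r. *)

(** Integrands live on [seq R], because [iint] builds the sample by consing; measurability is only
    meant on samples of the relevant length, seen as tuples. *)
Local Notation tuple_measurable_fun N G :=
  (measurable_fun [set: N.-tuple _] (fun t => G (tval t))).

(** * Laws of conditionally i.i.d. samples and their exchangeability *)

Section sample_law.
Context {R : realType}.
Implicit Types (D : probability R R) (Pi : prior R) (G : seq R -> \bar R).

Lemma eq_iint D N G G' : (forall s, size s = N -> G s = G' s) ->
  iint D N G = iint D N G'.
Proof.
elim: N G G' => [|N IH] G G' GG' /=; first exact: GG'.
by apply: eq_integral => x _; apply: IH => s sN; apply: GG'; rewrite /= sN.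
Qed.

Lemma eq_Exp Pi N G G' : (forall s, size s = N -> G s = G' s) ->
  Exp Pi N G = Exp Pi N G'.
Proof. by move=> GG'; apply: eq_integral => D _; exact: eq_iint. Qed.

(** Measurability into the Giry space is tested on evaluations at measurable sets, and these are
    measurable because the identity of [pprobability R R] defines a kernel. *)
Lemma measurable_pprobability_giry :
  measurable_fun [set: pprobability R R]
    (fun D => (D : probability R R) : giry R R).
Proof.
apply: measurable_giry_codensity => // B mB.
pose mid := @measurable_id _ (pprobability R R) setT.
exact: (measurable_kernel (kprobability mid) B mB).
Qed.

(* The N-fold product law of a random D, as a measurable function of D. *)
Lemma iint_giry (N : nat) :
  exists2 K : pprobability R R -> giry (N.-tuple R) R,
    measurable_fun setT K &
    forall D G, (forall s, 0 <= G s)%E -> tuple_measurable_fun N G ->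
      giry_int (K D) (fun t => G t) = iint D N G.
Proof.
elim: N => [|N [K mK KE]].
  exists (fun=> giry_ret [tuple]); first exact: measurable_cst.
  by move=> D G G0 mG; rewrite giry_int_ret.
have mcons : measurable_fun [set: R * N.-tuple R]
    (fun p => [tuple of p.1 :: p.2] : N.+1.-tuple R).
  by apply: measurable_cons => //.
(* The law of [N.+1] draws is the image under cons of the product of [D] with the law of [N] draws.
   Integrating the first factor outermost matches the order in [iint]. *)
exists (fun D => giry_map mcons
    (giry_prod ((D : probability R R) : giry R R, K D))).
  apply: measurableT_comp; first exact: measurable_giry_map.
  apply: measurableT_comp; first exact: measurable_giry_prod.
  by apply: measurable_fun_pair => //; exact: measurable_pprobability_giry.
move=> D G G0 mG; rewrite giry_int_map//.
have mGc : measurable_fun setT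
    ((fun t : N.+1.-tuple R => G t) \o
       (fun p : R * N.-tuple R => [tuple of p.1 :: p.2])).
  exact: measurableT_comp.
rewrite giry_int_prod1 => [|//|x]; last exact: G0.
rewrite /giry_int; apply: eq_integral => x _.
have mGx : tuple_measurable_fun N (fun s => G (x :: s)).
  apply: (@measurableT_comp _ _ _ _ _ _ (fun t : N.+1.-tuple R => G t)) => //.
  by apply: (@measurable_cons _ _ _ _ (cst x)).
exact: (KE D (fun s => G (x :: s)) (fun=> G0 _) mGx).
Qed.

Lemma iint_measure D N : exists mu : giry (N.-tuple R) R,
  forall G, (forall s, 0 <= G s)%E -> tuple_measurable_fun N G ->
    (iint D N G = \int[mu]_t G t)%E.
Proof.
have [K _ KE] := iint_giry N.
by exists (K D) => G G0 mG; rewrite -KE.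
Qed.

(** The Giry bind mixes the product laws over [Pi] into one measure, so that facts about [Exp]
    follow from the ordinary integral of nonnegative functions. *)
Lemma Exp_measure Pi N : exists mu : giry (N.-tuple R) R,
  forall G, (forall s, 0 <= G s)%E -> tuple_measurable_fun N G ->
    (Exp Pi N G = \int[mu]_t G t)%E.
Proof.
have [K mK KE] := iint_giry N.
exists (giry_bind (Pi : giry (pprobability R R) R) mK) => G G0 mG.
have := @giry_int_bind _ _ _ _ _ (Pi : giry (pprobability R R) R) _ mK
   (fun t => G t) mG (fun t => G0 t).
rewrite {1}/giry_int => ->.
by rewrite /giry_int; apply: eq_integral => D _; rewrite -KE.
Qed.

Lemma measurable_nth N j :
  measurable_fun [set: N.-tuple R] (fun t => nth 0 t j).
Proof.
have [jN|Nj] := ltnP j N.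
  rewrite (_ : (fun _ => _) = (fun t => tnth t (Ordinal jN))).
    exact: measurable_tnth.
  by apply/funext => t; rewrite (tnth_nth 0).
rewrite (_ : (fun _ => _) = cst 0); first exact: measurable_cst.
by apply/funext => t; rewrite nth_default// size_tuple.
Qed.

Lemma measurable_tuple_of_seq d (T : measurableType d) M (f : T -> seq R) :
  (forall j, measurable_fun setT (fun x => nth 0 (f x) j)) ->
  measurable_fun setT (fun x => tuple_of_seq M (f x)).
Proof.
move=> mf; apply/measurable_fun_tnthP => i.
rewrite (_ : _ \o _ = (fun x => nth 0 (f x) i)); first exact: mf.
by apply/funext => x /=; rewrite tnth_mktuple.
Qed.

Lemma tuple_of_seqK M (s : seq R) : size s = M -> tuple_of_seq M s = s :> seq R.
Proof.
move=> sM; apply: (@eq_from_nth _ 0); first by rewrite size_tuple.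
move=> i; rewrite size_tuple => iM.
by rewrite -(tnth_nth _ _ (Ordinal iM)) tnth_mktuple.
Qed.

Lemma nth_map_nth (s : seq R) (q : seq nat) i :
  nth 0 [seq nth 0 s j | j <- q] i =
  if (i < size q)%N then nth 0 s (nth 0%N q i) else 0.
Proof.
by case: ltnP => iq; [rewrite (nth_map 0%N)|rewrite nth_default// size_map].
Qed.

Lemma measurable_reindex N (q : seq nat) :
  measurable_fun [set: N.-tuple R]
    (fun t => tuple_of_seq (size q) [seq nth 0 t j | j <- q]).
Proof.
apply: measurable_tuple_of_seq => j.
under eq_fun do rewrite nth_map_nth.
by case: (j < size q)%N; [exact: measurable_nth|exact: measurable_cst].
Qed.

Lemma tuple_measurable_reindex N (q : seq nat) G :
  tuple_measurable_fun (size q) G ->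
  tuple_measurable_fun N (fun s => G [seq nth 0 s j | j <- q]).
Proof.
move=> mG.
rewrite (_ : (fun t : N.-tuple R => _) = (fun t => G (val t)) \o
    (fun t : N.-tuple R => tuple_of_seq (size q) [seq nth 0 t j | j <- q])).
  by apply: measurableT_comp => //; exact: measurable_reindex.
by apply/funext => t /=; rewrite tuple_of_seqK// size_map.
Qed.

(** The sides are indexed by all of [nat], so that removing the first one is the shift [A \o S] and
    needs no cast between ordinals. *)
Definition rectangle N (A : nat -> set R) : set (N.-tuple R) :=
  [set t | forall i : 'I_N, A i (tnth t i)].
Arguments rectangle N A : clear implicits.

Lemma measurable_rectangle N A : (forall i, measurable (A i)) ->
  measurable (rectangle N A).
Proof.
move=> mA.
rewrite (_ : rectangle N A =
    \bigcap_(i in [set: 'I_N]) (fun t => A i (tnth t i))); last first.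
  by apply/seteqP; split => t At i /=; [move=> _; exact: At|exact: (At i I)].
apply: fin_bigcap_measurable; first exact: finite_finset.
move=> i _; have := @measurable_tnth _ _ N i measurableT (A i) (mA i).
by rewrite setTI.
Qed.

(** Rectangles are stable under intersection, contain the whole space and generate the product
    sigma-algebra, so uniqueness of measures applies. *)
Lemma giry_eq_rectangle N (m1 m2 : giry (N.-tuple R) R) :
  (forall A, (forall i, measurable (A i)) ->
    m1 (rectangle N A) = m2 (rectangle N A)) ->
  forall B, measurable B -> m1 B = m2 B.
Proof.
move=> m12 B mB.
pose H := [set rectangle N A | A in [set A | forall i, measurable (A i)]].
have HT : H setT.
  by exists (fun=> setT) => [i|]; [exact: measurableT|apply/seteqP; split].
apply: (measure_unique H (fun=> setT)) => //.
- apply/seteqP; split; last first.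
    apply: smallest_sub; first exact: sigma_algebra_measurable.
    by move=> _ [A mA <-]; exact: measurable_rectangle.
  apply: smallest_sub; first exact: smallest_sigma_algebra.
  move=> C; rewrite -bigcup_seq/= => -[i _ [Y mY <-]].
  apply: sub_sigma_algebra.
  (* A generating cylinder constrains coordinate [i] only: it is the rectangle whose other sides are
     full. *)
  exists (fun j : nat => if j == i :> nat then Y else setT).
    by move=> j; case: ifP.
  rewrite setTI; apply/seteqP; split => t /= h.
    by have := h i; rewrite eqxx.
  by move=> j; case: eqP => // /val_inj ->.
- move=> _ _ [A mA <-] [A' mA' <-].
  exists (fun i => A i `&` A' i); first by move=> i; exact: measurableI.
  apply/seteqP; split => t /=.
    by move=> h; split=> i; have [] := h i.
  by move=> [h h'] i; split.
- by rewrite bigcup_const//; exists 0%N.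
- by move=> _ [A mA <-]; exact: m12.
- by move=> _; rewrite (le_lt_trans sprobability_setT)// ltry.
Qed.

(** The constant [c] is there for the induction: it absorbs the indicator of the first coordinate
    before the inner integrals are evaluated. *)
Lemma iint_rectangle D N (A : nat -> set R) (c : R) :
  (forall i, measurable (A i)) -> 0 <= c ->
  iint D N (fun s => (c * \prod_(i < N) \1_(A i) (nth 0 s i))%:E) =
  (c * \prod_(i < N) fine (D (A i)))%:E.
Proof.
elim: N A c => [|N IH] A c mA c0 /=; first by rewrite !big_ord0.
under eq_integral => x _.
  under (@eq_iint D N) => s _ do rewrite big_ord_recl /= mulrA.
  rewrite (IH (A \o S) _ (fun i => mA i.+1)); last first.
    by rewrite mulr_ge0// indicE ler0n.
  rewrite mulrAC EFinM.
  over.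
rewrite big_ord_recl/= [in RHS]mulrCA [in RHS]mulrC [RHS]EFinM.
rewrite fineK ?fin_num_measure//.
rewrite ge0_integralZl//=.
- by rewrite integral_indic// setIT.
- by apply/measurable_EFinP; exact: measurable_indic.
- by rewrite lee_fin mulr_ge0// prodr_ge0// => i _; rewrite fine_ge0.
Qed.

Lemma prod_indic_rectangle N (A : nat -> set R) (t : N.-tuple R) :
  \prod_(i < N) \1_(A i) (nth 0 t i) = \1_(rectangle N A) t :> R.
Proof.
have [tA|tA] := pselect (rectangle N A t).
  rewrite indicE mem_set//; apply: big1 => i _.
  by rewrite indicE mem_set// -tnth_nth.
rewrite indicE memNset//; have /existsNP[i Ai] := tA.
by rewrite (bigD1 i)//= indicE -tnth_nth memNset// mul0r.
Qed.

Lemma iint_measure_rectangle D N (mu : giry (N.-tuple R) R) :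
  (forall G, (forall s, 0 <= G s)%E -> tuple_measurable_fun N G ->
    (iint D N G = \int[mu]_t G t)%E) ->
  forall A, (forall i, measurable (A i)) ->
    mu (rectangle N A) = (\prod_(i < N) fine (D (A i)))%:E.
Proof.
move=> muE A mA; have mR := measurable_rectangle (N := N) mA.
rewrite -[rectangle N A]setIT -integral_indic//.
rewrite -[\prod_(_ < _) _]mul1r -iint_rectangle// muE => [|s|].
- by apply: eq_integral => t _; rewrite mul1r prod_indic_rectangle.
- by rewrite lee_fin mul1r prodr_ge0.
- under eq_fun => t do rewrite mul1r prod_indic_rectangle.
  by apply/measurable_EFinP; exact: measurable_indic.
Qed.

(** A selection of distinct coordinates of an i.i.d. sample is again i.i.d.: its law gives every
    rectangle the product of the masses of the sides. This covers both permuting coordinates and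
    forgetting some. *)
Lemma iint_reindex D N (q : seq nat) G :
  uniq q -> all (ltn^~ N) q -> (forall s, 0 <= G s)%E ->
  tuple_measurable_fun (size q) G ->
  iint D N (fun s => G [seq nth 0 s j | j <- q]) = iint D (size q) G.
Proof.
move=> uq qN G0 mG.
have [mu muE] := iint_measure D N.
have [nu nuE] := iint_measure D (size q).
rewrite muE//; last exact: (tuple_measurable_reindex mG).
rewrite nuE//.
pose phi (t : N.-tuple R) := tuple_of_seq (size q) [seq nth 0 t j | j <- q].
have mphi : measurable_fun setT phi by exact: measurable_reindex.
transitivity (\int[giry_map mphi mu]_t G t)%E.
  rewrite [RHS](giry_int_map mphi mu mG)//.
  apply: eq_integral => t _ /=.
  by rewrite tuple_of_seqK// size_map.
apply: eq_measure_integral => B mB _; move: B mB.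
apply: giry_eq_rectangle => A mA.
(* Preimage of the rectangle under the selection: a selected coordinate carries the side of its
   place in [q], the others are free. *)
pose B j := if j \in q then A (index j q) else setT.
have mB j : measurable (B j) by rewrite /B; case: ifP.
have -> : giry_map mphi mu (rectangle (size q) A) = mu (rectangle N B).
  rewrite /giry_map/= /pushforward; congr (mu _).
  apply/seteqP; split => t /= tA.
    move=> j; rewrite /B; case: ifPn => // jq.
    have iq : (index (val j) q < size q)%N by rewrite index_mem.
    have := tA (Ordinal iq).
    by rewrite tnth_mktuple nth_map_nth iq nth_index// -tnth_nth.
  move=> i; rewrite tnth_mktuple nth_map_nth ltn_ord.
  have iN : (nth 0%N q i < N)%N by exact: (all_nthP _ qN).
  have := tA (Ordinal iN).
  by rewrite /B/= mem_nth// index_uniq// (tnth_nth 0).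
rewrite (iint_measure_rectangle muE)// (iint_measure_rectangle nuE)//.
congr EFin; pose a i := fine (D (A i)).
(* Free coordinates contribute the total mass 1; what remains is a product over a permutation of
   [q]. *)
transitivity (\prod_(j <- iota 0 N | j \in q) a (index j q)).
  rewrite -[X in iota _ X]subn0 big_mkord [RHS]big_mkcond/=.
  apply: eq_bigr => j _; rewrite /B; case: ifP => // _.
  by rewrite probability_setT.
rewrite -big_filter (perm_big q); last first.
  apply: uniq_perm => //; first by rewrite filter_uniq// iota_uniq.
  move=> j; rewrite mem_filter mem_iota/= add0n.
  by case: (boolP (j \in q)) => //= /(allP qN) /= ->.
rewrite (big_nth 0%N) big_mkord; apply: eq_bigr => i _.
by rewrite index_uniq.
Qed.

Lemma Exp_reindex Pi N M (q : seq nat) G :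
  size q = M -> uniq q -> all (ltn^~ N) q -> (forall s, 0 <= G s)%E ->
  tuple_measurable_fun M G ->
  Exp Pi N (fun s => G [seq nth 0 s j | j <- q]) = Exp Pi M G.
Proof. by move=> <- *; apply: eq_integral => D _; exact: iint_reindex. Qed.

End sample_law.
Arguments rectangle {R} N A.

(** * From indicators to nonnegative measurable test functions *)

Section simple_function_extension.
Context d d' (T : measurableType d) (S : measurableType d') (R : realType)
  (mu : {measure set T -> \bar R}) (pi : T -> S).
Hypothesis mpi : measurable_fun setT pi.
Import HBNNSimple.

Let integral_nnsfun_mul (g : {nnsfun S >-> R}) (u : T -> R) :
  measurable_fun setT u -> (forall t, 0 <= u t) ->
  (\int[mu]_t (g (pi t) * u t)%:E =
   \sum_(r \in range g)
      (r%:E * \int[mu]_t (\1_(g @^-1` [set r]) (pi t) * u t)%:E))%E.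
Proof.
move=> mu_ u0.
have m1 r : measurable_fun setT (fun t => \1_(g @^-1` [set r]) (pi t) * u t).
  by apply: measurable_funM => //; apply: measurableT_comp.
have i0 r t : 0 <= \1_(g @^-1` [set r]) (pi t) * u t.
  by rewrite mulr_ge0// indicE ler0n.
(* This holds for negative [r] too, since [g] is nonnegative and its level set at [r] is then
   empty. *)
have ri0 r t : (0 <= r%:E * (\1_(g @^-1` [set r]) (pi t) * u t)%:E)%E.
  by rewrite EFinM muleA mule_ge0 ?nnfun_muleindic_ge0// lee_fin.
transitivity (\int[mu]_t (\sum_(r \in range g)
    (r%:E * (\1_(g @^-1` [set r]) (pi t) * u t)%:E)))%E.
  apply: eq_integral => t _; rewrite (fimfunE g) !fsbig_finite// mulr_suml.
  by rewrite -sumEFin; apply: eq_bigr => r _; rewrite -EFinM mulrA.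
rewrite ge0_integral_fsum//; last first.
  by move=> r; apply: measurable_funeM; exact/measurable_EFinP.
apply: eq_fsbigr => r; rewrite inE => -[x _ <-].
rewrite ge0_integralZl//.
- exact/measurable_EFinP.
- by move=> t _; rewrite lee_fin.
- by rewrite lee_fin.
Qed.

(* Extends the defining property of a conditional expectation from indicators
   to nonnegative test functions. *)
Lemma integral_mul_test (u w : T -> R) :
  measurable_fun setT u -> measurable_fun setT w ->
  (forall t, 0 <= u t) -> (forall t, 0 <= w t) ->
  (forall A, measurable A ->
    \int[mu]_t (\1_A (pi t) * u t)%:E = \int[mu]_t (\1_A (pi t) * w t)%:E)%E ->
  forall v : S -> R, measurable_fun setT v -> (forall y, 0 <= v y) ->
  (\int[mu]_t (v (pi t) * u t)%:E = \int[mu]_t (v (pi t) * w t)%:E)%E.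
Proof.
move=> mu_ mw u0 w0 uw v mv v0.
have mEv : measurable_fun setT (EFin \o v) by exact/measurable_EFinP.
(* The simple functions [g n] increase to [v]; monotone convergence reduces the equality to each
   [g n], hence to the indicators of its level sets. *)
pose g := nnsfun_approx measurableT mEv.
have approx (f : T -> R) : measurable_fun setT f -> (forall t, 0 <= f t) ->
  (\int[mu]_t (v (pi t) * f t)%:E =
     limn (fun n => \int[mu]_t (g n (pi t) * f t)%:E))%E.
  move=> mf f0; rewrite -monotone_convergence//.
  - apply: eq_integral => t _; apply/esym/cvg_lim => //.
    under eq_fun do rewrite EFinM; rewrite EFinM.
    apply: cvgeZr => //.
    apply: (@cvg_nnsfun_approx _ _ _ _ measurableT _ mEv) => // y _.
    by rewrite lee_fin.
  - move=> n; apply/measurable_EFinP; apply: measurable_funM => //.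
    exact: measurableT_comp.
  - by move=> n t _; rewrite lee_fin mulr_ge0.
  - move=> t _ m n mn; rewrite lee_fin ler_wpM2r//.
    exact/lefP/nd_nnsfun_approx.
rewrite !approx//; congr (limn _); apply/funext => n.
rewrite !integral_nnsfun_mul//; apply: eq_fsbigr => r _.
by rewrite uw.
Qed.

End simple_function_extension.

(** * Linearity of [Exp], almost sure vanishing and the Pythagorean identity *)

Section Exp_theory.
Context {R : realType}.
Implicit Types (Pi : prior R) (f g u v w : seq R -> R).

Lemma ExpD Pi N f g :
  (forall s, 0 <= f s) -> (forall s, 0 <= g s) ->
  tuple_measurable_fun N f -> tuple_measurable_fun N g ->
  (Exp Pi N (fun s => (f s + g s)%:E) =
   Exp Pi N (fun s => (f s)%:E) + Exp Pi N (fun s => (g s)%:E))%E.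
Proof.
move=> f0 g0 mf mg; have [mu muE] := Exp_measure Pi N.
rewrite !muE.
- rewrite -ge0_integralD//; try exact/measurable_EFinP.
    by move=> x _; rewrite lee_fin.
  by move=> x _; rewrite lee_fin.
- by move=> s; rewrite lee_fin.
- exact/measurable_EFinP.
- by move=> s; rewrite lee_fin.
- exact/measurable_EFinP.
- by move=> s; rewrite lee_fin addr_ge0.
- by apply/measurable_EFinP; exact: measurable_funD.
Qed.

Lemma ExpZ Pi N (c : R) f : 0 <= c -> (forall s, 0 <= f s) ->
  tuple_measurable_fun N f ->
  (Exp Pi N (fun s => (c * f s)%:E) = c%:E * Exp Pi N (fun s => (f s)%:E))%E.
Proof.
move=> c0 f0 mf; have [mu muE] := Exp_measure Pi N.
rewrite !muE.
- rewrite -ge0_integralZl//; first exact/measurable_EFinP.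
  by move=> x _; rewrite lee_fin.
- by move=> s; rewrite lee_fin.
- exact/measurable_EFinP.
- by move=> s; rewrite lee_fin mulr_ge0.
- by apply/measurable_EFinP; exact: measurable_funM.
Qed.

Lemma Exp_sum Pi N n (f : nat -> seq R -> R) :
  (forall p s, 0 <= f p s) -> (forall p, tuple_measurable_fun N (f p)) ->
  (Exp Pi N (fun s => (\sum_(p < n) f p s)%:E) =
   \sum_(p < n) Exp Pi N (fun s => (f p s)%:E))%E.
Proof.
move=> f0 mf; elim: n => [|n IH].
  rewrite big_ord0; have [mu muE] := Exp_measure Pi N.
  under eq_Exp => s _ do rewrite big_ord0.
  by rewrite muE// integral0.
rewrite big_ord_recr/= -IH -ExpD//.
- by apply: eq_Exp => s _; rewrite big_ord_recr.
- by move=> s; rewrite sumr_ge0.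
- exact: measurable_sum.
Qed.

Lemma Exp_ge0 Pi N f : (forall s, 0 <= f s) -> tuple_measurable_fun N f ->
  (0 <= Exp Pi N (fun s => (f s)%:E))%E.
Proof.
move=> f0 mf; have [mu muE] := Exp_measure Pi N.
rewrite muE; last 2 first.
- by move=> s; rewrite lee_fin.
- exact/measurable_EFinP.
by apply: integral_ge0 => t _; rewrite lee_fin.
Qed.

Lemma Exp_fin_num Pi N f (c : R) : (forall s, 0 <= f s <= c) ->
  tuple_measurable_fun N f -> Exp Pi N (fun s => (f s)%:E) \is a fin_num.
Proof.
move=> f01 mf; have f0 s : 0 <= f s by case/andP: (f01 s).
rewrite ge0_fin_numE ?Exp_ge0//; have [mu muE] := Exp_measure Pi N.
rewrite muE; last 2 first.
- by move=> s; rewrite lee_fin.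
- exact/measurable_EFinP.
apply: (@le_lt_trans _ _ (\int[mu]_t (cst c%:E) t)%E).
  apply: ge0_le_integral => //.
  - by move=> t _; rewrite lee_fin.
  - exact/measurable_EFinP.
  - by move=> t _; rewrite lee_fin; case/andP: (f01 t).
rewrite integral_cst// lte_mul_pinfty//.
  by rewrite lee_fin (le_trans (f0 [::]))//; case/andP: (f01 [::]).
by rewrite (le_lt_trans sprobability_setT)// ltry.
Qed.

(** A nonnegative function with null integral vanishes almost everywhere; the conclusion has the
    shape used in [degenerate] for almost sure equality. *)
Lemma Exp_eq0 Pi N f : (forall s, 0 <= f s) -> tuple_measurable_fun N f ->
  Exp Pi N (fun s => (f s)%:E) = 0%E ->
  Exp Pi N (fun s => (\1_[set s | f s != 0] s)%:E) = 0%E.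
Proof.
move=> f0 mf; have [mu muE] := Exp_measure Pi N.
have mfE : measurable_fun [set: N.-tuple R] (fun t => (f t)%:E).
  exact/measurable_EFinP.
rewrite muE; [|by move=> s; rewrite lee_fin|exact: mfE].
move=> fE0.
have mS : measurable [set t : N.-tuple R | f t != 0].
  rewrite (_ : mkset _ = setT `&` [set t : N.-tuple R | (f t)%:E != 0%E]).
    exact: emeasurable_neq.
  by rewrite setTI; apply/seteqP; split => t /=; rewrite eqe.
have ind (t : N.-tuple R) :
    \1_[set s | f s != 0] (t : seq R) =
    \1_[set t : N.-tuple R | f t != 0] t :> R.
  rewrite !indicE; congr (_%:R); congr nat_of_bool;
    by apply/idP/idP; rewrite !inE.
rewrite muE.
- under eq_integral => t _ do rewrite ind.
  rewrite integral_indic// setIT.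
  have : ae_eq mu setT (fun t : N.-tuple R => (f t)%:E) (cst 0%E).
    apply/ae_eq_integral_abs => //.
    rewrite -[RHS]fE0; apply: eq_integral => t _.
    by rewrite gee0_abs// lee_fin.
  move=> [C [mC C0 fC]]; apply: (subset_measure0 _ _ _ C0) => //.
  move=> t /= ft; apply: fC => /= /(_ I)[]; exact/eqP.
- by move=> s; rewrite lee_fin indicE ler0n.
- apply/measurable_EFinP; under eq_fun do rewrite ind.
  exact: measurable_indic.
Qed.

(** The last two hypotheses say that [w - u] is orthogonal to [u] and to [v], so [u] plays the role
    of the projection of [w] and [v] that of a competitor. *)
Lemma Exp_pythagoras Pi N u v w :
  tuple_measurable_fun N u -> tuple_measurable_fun N v ->
  tuple_measurable_fun N w ->
  (forall s, 0 <= u s <= 1) -> (forall s, 0 <= v s <= 1) ->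
  (forall s, 0 <= w s <= 1) ->
  Exp Pi N (fun s => (u s * u s)%:E) = Exp Pi N (fun s => (u s * w s)%:E) ->
  Exp Pi N (fun s => (v s * u s)%:E) = Exp Pi N (fun s => (v s * w s)%:E) ->
  (Exp Pi N (fun s => ((v s - w s) ^+ 2)%:E) =
   Exp Pi N (fun s => ((u s - w s) ^+ 2)%:E) +
   Exp Pi N (fun s => ((v s - u s) ^+ 2)%:E))%E.
Proof.
move=> mu mv mw u01 v01 w01 uuE vuE.
have ge0 f : (forall s, 0 <= f s <= 1) -> forall s, 0 <= f s.
  by move=> f01 s; case/andP: (f01 s).
have u0 := ge0 _ u01; have v0 := ge0 _ v01; have w0 := ge0 _ w01.
have M f g : tuple_measurable_fun N f -> tuple_measurable_fun N g ->
  tuple_measurable_fun N (fun s => f s * g s).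
  by move=> mf mg; exact: measurable_funM.
have B f g : tuple_measurable_fun N f -> tuple_measurable_fun N g ->
  tuple_measurable_fun N (fun s => (f s - g s) ^+ 2).
  by move=> mf mg; apply: measurable_funX; exact: measurable_funB.
have A f g : tuple_measurable_fun N f -> tuple_measurable_fun N g ->
  tuple_measurable_fun N (fun s => f s + g s).
  by move=> mf mg; exact: measurable_funD.
have P f g : (forall s, 0 <= f s) -> (forall s, 0 <= g s) ->
    forall s, 0 <= f s * g s by move=> *; exact: mulr_ge0.
(* [ExpD] only adds nonnegative functions, so the cross terms are moved across: [(v - w)^2 + c']
   equals [(u - w)^2 + (v - u)^2 + c''] pointwise. By orthogonality [c'] and [c''] have the same
   expectation, which is finite and cancels. *)
pose c' s := v s * w s + u s * u s + (v s * w s + u s * u s).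
have ma := A (fun s => v s * w s) (fun s => u s * u s)
  (M v w mv mw) (M u u mu mu).
have mc' : tuple_measurable_fun N c' :=
  A (fun s => v s * w s + u s * u s) (fun s => v s * w s + u s * u s) ma ma.
have c'0 s : 0 <= c' s by rewrite !addr_ge0 ?mulr_ge0.
pose c'' s := u s * w s + v s * u s + (u s * w s + v s * u s).
have mb := A (fun s => u s * w s) (fun s => v s * u s)
  (M u w mu mw) (M v u mv mu).
have mc'' : tuple_measurable_fun N c'' :=
  A (fun s => u s * w s + v s * u s) (fun s => u s * w s + v s * u s) mb mb.
have c''0 s : 0 <= c'' s by rewrite !addr_ge0 ?mulr_ge0.
have cE : Exp Pi N (fun s => (c' s)%:E) = Exp Pi N (fun s => (c'' s)%:E).
  have a0 s : 0 <= v s * w s + u s * u s by rewrite addr_ge0 ?mulr_ge0.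
  have b0 s : 0 <= u s * w s + v s * u s by rewrite addr_ge0 ?mulr_ge0.
  have E : Exp Pi N (fun s => (v s * w s + u s * u s)%:E) =
           Exp Pi N (fun s => (u s * w s + v s * u s)%:E).
    rewrite (ExpD _ (P v w v0 w0) (P u u u0 u0) (M v w mv mw) (M u u mu mu)).
    rewrite (ExpD _ (P u w u0 w0) (P v u v0 u0) (M u w mu mw) (M v u mv mu)).
    by rewrite uuE vuE addeC.
  by rewrite (ExpD _ a0 a0 ma ma) (ExpD _ b0 b0 mb mb) E.
have cfin : Exp Pi N (fun s => (c' s)%:E) \is a fin_num.
  (* [c'] is a sum of four products of numbers in [0, 1]. *)
  apply: (@Exp_fin_num _ _ _ 4) => // s; rewrite c'0/= /c'.
  move: (u01 s) (v01 s) (w01 s) => /andP[? ?] /andP[? ?] /andP[? ?].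
  by nra.
have sq0 (f g : seq R -> R) s : 0 <= (f s - g s) ^+ 2 by exact: sqr_ge0.
rewrite -[LHS](addeK _ cfin) -[RHS](addeK _ cfin); congr (_ - _)%E.
rewrite [in RHS]cE.
have Bvw := B v w mv mw; have Buw := B u w mu mw; have Bvu := B v u mv mu.
rewrite -(ExpD _ (sq0 v w) c'0 Bvw mc').
rewrite -(ExpD _ (sq0 u w) (sq0 v u) Buw Bvu).
have s0 s : 0 <= (u s - w s) ^+ 2 + (v s - u s) ^+ 2 by rewrite addr_ge0.
rewrite -(ExpD _ s0 c''0 (A (fun s => (u s - w s) ^+ 2)
  (fun s => (v s - u s) ^+ 2) Buw Bvu) mc'').
by apply: eq_Exp => s _; congr EFin; rewrite /c' /c''; ring.
Qed.

End Exp_theory.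

(** * Empirical distribution functions and their conditional expectations *)

Section ecdf_theory.
Context {R : realType}.
Implicit Types (Pi : prior R) (S : seq R).

Lemma ecdf_sum S (x : R) :
  ecdf S x = (size S)%:R^-1 * \sum_(j < size S) (nth 0 S j <= x)%R%:R.
Proof.
rewrite /ecdf mulrC; congr (_ * _).
by rewrite -sum1_count (big_nth 0) big_mkord natr_sum big_mkcond/=;
  apply: eq_bigr => i _; case: ifP.
Qed.

Lemma ecdf_ge0_le1 S (x : R) : 0 <= ecdf S x <= 1.
Proof.
rewrite /ecdf divr_ge0//=; have [->|S0] := posnP (size S).
  (* On an empty sample [ecdf] is 0, the inverse of 0 being 0. *)
  by rewrite invr0 mulr0.
by rewrite ler_pdivrMr ?ltr0n// mul1r ler_nat count_size.
Qed.

Lemma measurable_le_nth N i j : tuple_measurable_fun N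
  (fun s : seq R => (nth 0 s i <= nth 0 s j)%R%:R : R).
Proof.
rewrite (_ : (fun _ => _) =
    \1_[set t : N.-tuple R | nth 0 t i <= nth 0 t j]); last first.
  by apply/funext => t; rewrite indicE; congr (_%:R); congr nat_of_bool;
    apply/idP/idP; rewrite inE.
apply: measurable_indic; rewrite -[X in measurable X]setTI.
by apply: measurable_fun_le => //; exact: measurable_nth.
Qed.

Lemma measurable_ecdf N k l : tuple_measurable_fun N
  (fun s : seq R => ecdf (drop k s) (nth 0 s l)).
Proof.
under eq_fun => t.
  rewrite ecdf_sum size_drop size_tuple.
  under eq_bigr do rewrite nth_drop.
  over.
apply: measurable_funM => //.
by apply: measurable_sum => j; exact: measurable_le_nth.
Qed.

Lemma tuple_of_seq_cat n (s s' : seq R) : (n <= size s)%N ->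
  tuple_of_seq n (take n s ++ s') = tuple_of_seq n s.
Proof.
move=> ns; apply: eq_from_tnth => i; rewrite !tnth_mktuple nth_cat.
by rewrite size_takel// ltn_ord nth_take.
Qed.

Lemma tuple_of_seq_take n (s : seq R) : (n <= size s)%N ->
  tuple_of_seq n s = take n s :> seq R.
Proof.
move=> ns; apply: (@eq_from_nth _ 0); first by rewrite size_tuple size_takel.
move=> i; rewrite size_tuple => i_n.
by rewrite -(tnth_nth _ _ (Ordinal i_n)) tnth_mktuple nth_take.
Qed.

Lemma measurable_prefix N n :
  measurable_fun setT (fun t : N.-tuple R => tuple_of_seq n t).
Proof. by apply: measurable_tuple_of_seq => j; exact: measurable_nth. Qed.

Lemma measurable_comp_prefix N n (v : n.-tuple R -> R) :
  measurable_fun setT v ->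
  tuple_measurable_fun N (fun s => v (tuple_of_seq n s)).
Proof.
by move=> mv; apply: measurableT_comp => //; exact: measurable_prefix.
Qed.

(** Taking for [v] first [g] itself and then a competing prediction yields the two orthogonality
    relations of [Exp_pythagoras]. *)
Lemma cond_ecdf_test Pi k r (g : k.+1.-tuple R -> R) :
  (forall y, 0 <= g y) -> is_cond_ecdf Pi r g ->
  forall v : k.+1.-tuple R -> R, measurable_fun setT v ->
  (forall y, 0 <= v y) ->
  Exp Pi (k.+1 + r)
    (fun s => (v (tuple_of_seq k.+1 s) * g (tuple_of_seq k.+1 s))%:E) =
  Exp Pi (k.+1 + r)
    (fun s => (v (tuple_of_seq k.+1 s) * ecdf (drop k.+1 s) (nth 0 s k))%:E).
Proof.
move=> g0 [mg gE] v mv v0.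
have [mu muE] := Exp_measure Pi (k.+1 + r).
have e0 (s : seq R) : 0 <= ecdf (drop k.+1 s) (nth 0 s k).
  by case/andP: (ecdf_ge0_le1 (drop k.+1 s) (nth 0 s k)).
have mp := @measurable_prefix (k.+1 + r) k.+1.
have me := @measurable_ecdf (k.+1 + r) k.+1 k.
have muM (f : k.+1.-tuple R -> R) (w : seq R -> R) :
    measurable_fun setT f -> (forall y, 0 <= f y) ->
    tuple_measurable_fun (k.+1 + r) w -> (forall s, 0 <= w s) ->
    Exp Pi (k.+1 + r) (fun s => (f (tuple_of_seq k.+1 s) * w s)%:E) =
    (\int[mu]_t (f (tuple_of_seq k.+1 t) * w t)%:E)%E.
  move=> mf f0 mw w0; apply: muE; first by move=> s; rewrite lee_fin mulr_ge0.
  apply/measurable_EFinP; apply: measurable_funM => //.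
  exact: measurableT_comp.
have mgp := measurable_comp_prefix (N := k.+1 + r) mg.
have gp0 s : 0 <= g (tuple_of_seq k.+1 s) by [].
rewrite (muM v (fun s => g (tuple_of_seq k.+1 s)) mv v0 mgp gp0).
rewrite (muM v (fun s => ecdf (drop k.+1 s) (nth 0 s k)) mv v0 me e0).
apply: (integral_mul_test mp mgp me) => // A mA.
have i0 y : 0 <= \1_A y :> R by rewrite indicE ler0n.
have mi : measurable_fun setT (\1_A : k.+1.-tuple R -> R).
  exact: measurable_indic.
rewrite -(muM \1_A (fun s => g (tuple_of_seq k.+1 s)) mi i0 mgp gp0).
by rewrite -(muM \1_A (fun s => ecdf (drop k.+1 s) (nth 0 s k)) mi i0 me e0) gE.
Qed.

(** The [ecdf] averages [r] indicators that, by exchangeability, have the same expectation against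
    any event in the first [k.+1] draws. One of them therefore suffices, which is the case [r = 1]
    used in [degenerate]. *)
Lemma is_cond_ecdf1 Pi k r (g : k.+1.-tuple R -> R) :
  (0 < r)%N -> (forall y, 0 <= g y) -> is_cond_ecdf Pi r g ->
  is_cond_ecdf Pi 1 g.
Proof.
move=> r0 g0 [mg gE]; split; [exact: mg|move=> A mA].
have i0 y : 0 <= \1_A y :> R by rewrite indicE ler0n.
have mi : measurable_fun setT (\1_A : k.+1.-tuple R -> R).
  exact: measurable_indic.
(* Positions of the first [k] points, of [T], and of the single comparison point numbered [j]. *)
pose q j := rcons (iota 0 k.+1) (k.+1 + j)%N.
have sq j : size (q j) = (k.+1 + 1)%N by rewrite size_rcons size_iota addn1.
have uq j : uniq (q j).
  by rewrite rcons_uniq iota_uniq mem_iota/= add0n -leqNgt leq_addr.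
have qN j : (j < r)%N -> all (ltn^~ (k.+1 + r)%N) (q j).
  move=> jr; rewrite all_rcons/= ltn_add2l jr; apply/allP => x.
  by rewrite mem_iota => /andP[_ xk]; exact: (leq_trans xk (leq_addr _ _)).
have qs j (s : seq R) : size s = (k.+1 + r)%N ->
    [seq nth 0 s j | j <- q j] = take k.+1 s ++ [:: nth 0 s (k.+1 + j)%N].
  by move=> sE; rewrite map_rcons map_nth_iota0 ?sE ?leq_addr// cats1.
have red (G : seq R -> R) j : (j < r)%N -> (forall s, 0 <= G s) ->
    tuple_measurable_fun (k.+1 + 1) G ->
    Exp Pi (k.+1 + 1) (fun s => (G s)%:E) =
    Exp Pi (k.+1 + r)
      (fun s => (G (take k.+1 s ++ [:: nth 0 s (k.+1 + j)%N]))%:E).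
  move=> jr G0 mG; have G0' s : (0 <= (G s)%:E)%E by rewrite lee_fin.
  have mG' : tuple_measurable_fun (k.+1 + 1) (fun s => (G s)%:E).
    exact/measurable_EFinP.
  rewrite -(Exp_reindex Pi (sq j) (uq j) (qN j jr) G0' mG').
  by apply: eq_Exp => s sN; rewrite qs.
have mgp N := measurable_comp_prefix (N := N) mg.
have mip N := measurable_comp_prefix (N := N) mi.
rewrite (red (fun s => \1_A (tuple_of_seq k.+1 s) * g (tuple_of_seq k.+1 s))
  0%N r0); last 2 first.
- by move=> s; rewrite mulr_ge0.
- exact: (measurable_funM (mip _) (mgp _)).
pose W j (s : seq R) : R :=
  \1_A (tuple_of_seq k.+1 s) * (nth 0 s (k.+1 + j)%N <= nth 0 s k)%R%:R.
have W0 j s : 0 <= W j s by rewrite mulr_ge0.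
have mW N j : tuple_measurable_fun N (W j).
  exact: (measurable_funM (mip _) (@measurable_le_nth _ _ _)).
transitivity (Exp Pi (k.+1 + 1) (fun s => (W 0%N s)%:E)); last first.
  apply: eq_Exp => s sE; congr EFin; rewrite /W ecdf_sum size_drop sE.
  by rewrite addKn invr1 mul1r big_ord1 nth_drop.
transitivity (Exp Pi (k.+1 + r) (fun s =>
    (\1_A (tuple_of_seq k.+1 s) * ecdf (drop k.+1 s) (nth 0 s k))%:E)).
  rewrite -(gE A mA); apply: eq_Exp => s sE.
  by rewrite tuple_of_seq_cat// sE leq_addr.
transitivity (Exp Pi (k.+1 + r)
    (fun s => (r%:R^-1 * \sum_(j < r) W j s)%:E)).
  apply: eq_Exp => s sE; congr EFin; rewrite ecdf_sum size_drop sE addKn.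
  rewrite mulrCA mulr_sumr; congr (_ * _).
  by apply: eq_bigr => j _; rewrite /W nth_drop.
rewrite (@ExpZ _ Pi _ _ (fun s => \sum_(j < r) W j s)); last 3 first.
- by rewrite invr_ge0.
- by move=> s; rewrite sumr_ge0.
- by apply: measurable_sum => j; exact: mW.
rewrite Exp_sum//.
have WE j : (j < r)%N ->
    Exp Pi (k.+1 + r) (fun s => (W j s)%:E) =
    Exp Pi (k.+1 + 1) (fun s => (W 0%N s)%:E).
  move=> jr; rewrite (red (W 0%N) j jr (W0 0%N) (mW _ 0%N)).
  apply: eq_Exp => s sE.
  congr EFin; rewrite /W tuple_of_seq_cat ?sE ?leq_addr// !nth_cat addn0.
  by rewrite size_takel ?sE ?leq_addr// ltnn subnn ltnSn nth_take.
rewrite (eq_bigr (fun=> Exp Pi (k.+1 + 1) (fun s => (W 0%N s)%:E))); last first.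
  by move=> j _; exact: WE.
(* Finiteness lets the average of [r] equal terms be simplified in [R]. *)
have fin : Exp Pi (k.+1 + 1) (fun s => (W 0%N s)%:E) \is a fin_num.
  apply: (@Exp_fin_num _ _ _ _ 1) => // s; rewrite W0 /W indicE.
  by rewrite -natrM lern1; case: (_ \in _); case: (_ <= _).
rewrite -(fineK fin) sumEFin sumr_const card_ord -EFinM.
by rewrite -[X in _ * X]mulr_natl mulKf// pnatr_eq0 -lt0n.
Qed.

End ecdf_theory.

(** The sample [s] lists the agent's [k] points, then [T] at position [k], then the points of [Z]. A
    strategy may change the number of points, so [h] is taken at the reported size. *)
Definition prediction (R : realType) (h : forall k r : nat, k.+1.-tuple R -> R)
    (r : nat) (f : strategy R) (k : nat) (s : seq R) : R :=
  h (size (f (take k s))) r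
    (tuple_of_seq (size (f (take k s))).+1 (rcons (f (take k s)) (nth 0 s k))).

(* Expected loss of an agent holding k points and playing f, when the other
   agents together hold r + 1 points. *)
Definition risk (R : realType) (Pi : prior R)
    (h : forall k r : nat, k.+1.-tuple R -> R) (r : nat) (f : strategy R)
    (k : nat) : \bar R :=
  Exp Pi (k.+1 + r) (fun s =>
    ((prediction h r f k s - ecdf (drop k.+1 s) (nth 0 s k)) ^+ 2)%:E).

(** * Optimality of the truthful prediction and strict decrease of its risk *)

Section risk_theory.
Context {R : realType}.
Variables (Pi : prior R) (h : forall k r : nat, k.+1.-tuple R -> R).
Arguments h : clear implicits.
Hypothesis valid : valid_h Pi h.
Variable r : nat.
Hypothesis r0 : (0 < r)%N.

Let h01 k y : 0 <= h k r y <= 1. Proof. by have [] := valid k r0. Qed.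
Let h0 k y : 0 <= h k r y. Proof. by have /andP[] := h01 y. Qed.
Let cond_h k : is_cond_ecdf Pi r (h k r). Proof. by have [] := valid k r0. Qed.
Let mh k : measurable_fun setT (h k r). Proof. by have [] := cond_h k. Qed.

Lemma prediction_ge0_le1 f k s : 0 <= prediction h r f k s <= 1.
Proof. exact: h01. Qed.

Lemma prediction_id k s : (k < size s)%N ->
  prediction h r id k s = h k r (tuple_of_seq k.+1 s).
Proof.
move=> ks; rewrite /prediction size_takel 1?ltnW//; congr (h k r _).
rewrite -take_nth//; apply: eq_from_tnth => i; rewrite !tnth_mktuple.
by rewrite nth_take.
Qed.

Lemma prediction_prefix f k s : (k < size s)%N ->
  prediction h r f k (tuple_of_seq k.+1 s) = prediction h r f k s.
Proof.
move=> ks; rewrite /prediction.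
have -> : tuple_of_seq k.+1 s = take k.+1 s :> seq R.
  rewrite -(@tuple_of_seqK _ k.+1 (take k.+1 s)) ?size_takel//.
  by rewrite -(@tuple_of_seq_cat _ _ s [::])// cats0.
by rewrite take_takel// nth_take.
Qed.

(** The arity of [h] depends on the reported size, so the space is cut into countably many
    measurable pieces on which this size is a constant [l]; on each piece the prediction is [h l r]
    of measurable coordinates. *)
Lemma measurable_prediction f k : strategy_measurable f ->
  measurable_fun setT (fun y : k.+1.-tuple R => prediction h r f k y).
Proof.
move=> mf.
pose X (y : k.+1.-tuple R) := tuple_of_seq k y.
have mX : measurable_fun setT X by exact: measurable_prefix.
have XE y : X y = take k y :> seq R.
  by rewrite tuple_of_seq_take// size_tuple.
pose E l := [set x : k.-tuple R | size (f x) = l].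
have mE l : measurable (E l) by have [] := mf k l.
have mXE l : measurable (X @^-1` E l).
  by rewrite -[X in measurable X]setTI; exact: mX.
have -> : [set: k.+1.-tuple R] = \bigcup_l (X @^-1` E l).
  by apply/seteqP; split => // y _; exists (size (f (X y))).
apply/measurable_fun_bigcup => // l.
(* The first [l] coordinates come from the report, extended by 0 off [E l] to be measurable
   everywhere; the next one is [T]. *)
pose coord (j : nat) (y : k.+1.-tuple R) : R :=
  if (j < l)%N then ((fun x : k.-tuple R => nth 0 (f x) j) \_ (E l)) (X y)
  else nth 0 y k.
have mcoord j : measurable_fun setT (coord j).
  rewrite /coord; case: (j < l)%N; last exact: measurable_nth.
  apply: measurableT_comp => //; apply: (iffLR (measurable_restrictT _ (mE l))).
  by have [_ mfl] := mf k l; exact: mfl.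
pose Z (y : k.+1.-tuple R) := tuple_of_seq l.+1 (mkseq (coord ^~ y) l.+1).
have mZ : measurable_fun setT Z.
  apply: measurable_tuple_of_seq => j; have [jl|lj] := ltnP j l.+1.
    rewrite (_ : (fun _ => _) = coord j)//.
    by apply/funext => y; rewrite nth_mkseq.
  rewrite (_ : (fun _ => _) = cst 0)//.
  by apply/funext => y; rewrite nth_default// size_mkseq.
apply: (eq_measurable_fun (fun y => h l r (Z y))).
  move=> y; rewrite inE => yl; rewrite /prediction -XE.
  have -> : Z y = tuple_of_seq l.+1 (rcons (f (X y)) (nth 0 y k)).
    apply: eq_from_tnth => i; rewrite !tnth_mktuple nth_mkseq// nth_rcons.
    rewrite yl /coord patchE mem_set//; case: ifP => // il.
    by rewrite eqn_leq -ltnS ltn_ord leqNgt il.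
  by move: yl => /= <-.
apply: measurable_funTS.
exact: (measurableT_comp (@mh l) mZ).
Qed.

(** The excess risk of any prediction is its mean squared distance to [h]. Part (i) takes for [v]
    the prediction under a deviation, part (ii) a prediction that ignores one point. *)
Lemma cond_ecdf_pythagoras k (v : k.+1.-tuple R -> R) :
  measurable_fun setT v -> (forall y, 0 <= v y <= 1) ->
  (Exp Pi (k.+1 + r) (fun s => ((v (tuple_of_seq k.+1 s) -
     ecdf (drop k.+1 s) (nth 0 s k)) ^+ 2)%:E) =
   risk Pi h r id k +
   Exp Pi (k.+1 + r) (fun s => ((v (tuple_of_seq k.+1 s) -
     h k r (tuple_of_seq k.+1 s)) ^+ 2)%:E))%E.
Proof.
move=> mv v01; have v0 y : 0 <= v y by have /andP[] := v01 y.
pose u s := h k r (tuple_of_seq k.+1 s).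
have -> : risk Pi h r id k = Exp Pi (k.+1 + r)
    (fun s => ((u s - ecdf (drop k.+1 s) (nth 0 s k)) ^+ 2)%:E).
  by apply: eq_Exp => s sE; rewrite prediction_id// sE leq_addr.
apply: (@Exp_pythagoras _ Pi _ u (fun s => v (tuple_of_seq k.+1 s))
  (fun s => ecdf (drop k.+1 s) (nth 0 s k))).
- exact: measurable_comp_prefix.
- exact: measurable_comp_prefix.
- exact: measurable_ecdf.
- by move=> s; exact: h01.
- by move=> s; exact: v01.
- by move=> s; exact: ecdf_ge0_le1.
- exact: cond_ecdf_test.
- exact: cond_ecdf_test.
Qed.

Lemma risk_truthful_le f k : strategy_measurable f ->
  (risk Pi h r id k <= risk Pi h r f k)%E.
Proof.
move=> mf; have mp := @measurable_prediction f k mf.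
have -> : risk Pi h r f k = Exp Pi (k.+1 + r)
    (fun s => ((prediction h r f k (tuple_of_seq k.+1 s) -
                ecdf (drop k.+1 s) (nth 0 s k)) ^+ 2)%:E).
  by apply: eq_Exp => s sE; rewrite prediction_prefix// sE leq_addr.
rewrite (cond_ecdf_pythagoras mp) => [|y]; last exact: prediction_ge0_le1.
apply: leeDl; apply: (@Exp_ge0 _ _ _ (fun s => (prediction h r f k
  (tuple_of_seq k.+1 s) - h k r (tuple_of_seq k.+1 s)) ^+ 2)).
  by move=> s; exact: sqr_ge0.
apply: measurable_funX; apply: measurable_funB.
  exact: (measurable_comp_prefix mp).
exact: measurable_comp_prefix.
Qed.

(** In a sample of [k.+1] points followed by [T], position [k] holds the last point, which is
    skipped, and position [k.+1] holds [T]. The same tuple appears in [degenerate]. *)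
Definition forget_last k (s : seq R) := rcons (take k s) (nth 0 s k.+1).

Lemma size_forget_last k s : (k.+1 < size s)%N -> size (forget_last k s) = k.+1.
Proof. by move=> ks; rewrite size_rcons size_takel// ltnW// ltnW. Qed.

(** An additional draw at position [k] that nothing depends on leaves the expectation unchanged.
    This brings the risks for [k] and [k.+1] points to a common sample; the list [q] omits exactly
    position [k]. *)
Lemma risk_forget_last k : risk Pi h r id k =
  Exp Pi (k.+2 + r) (fun s => ((h k r (tuple_of_seq k.+1 (forget_last k s)) -
    ecdf (drop k.+2 s) (nth 0 s k.+1)) ^+ 2)%:E).
Proof.
pose q := iota 0 k ++ iota k.+1 r.+1.
have mloss : tuple_measurable_fun (k.+1 + r) (fun s =>
    ((prediction h r id k s - ecdf (drop k.+1 s) (nth 0 s k)) ^+ 2)).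
  apply: measurable_funX; apply: measurable_funB; last exact: measurable_ecdf.
  rewrite (_ : (fun _ => _) = (fun t => h k r (tuple_of_seq k.+1 (tval t)))).
    exact: measurable_comp_prefix.
  by apply/funext => t; rewrite prediction_id// size_tuple leq_addr.
rewrite /risk -(@Exp_reindex _ Pi (k.+2 + r) _ q).
- apply: eq_Exp => s sE; congr EFin.
  have ks : (k.+1 < size s)%N by rewrite sE leq_addr.
  have -> : [seq nth 0 s j | j <- q] = forget_last k s ++ drop k.+2 s.
    rewrite map_cat map_nth_iota0; last by rewrite ltnW// ltnW.
    rewrite map_nth_iota; last by rewrite sE; lia.
    rewrite [take r.+1 _]take_oversize; last by rewrite size_drop sE; lia.
    by rewrite (drop_nth 0 ks) cat_rcons.
  have sF := size_forget_last ks.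
  rewrite prediction_id; last by rewrite size_cat sF leq_addr.
  rewrite -{1}[forget_last k s](take_size) sF tuple_of_seq_cat ?sF//.
  rewrite drop_size_cat// nth_cat sF ltnSn nth_rcons.
  by rewrite size_takel ?ltnn ?eqxx// ltnW// ltnW.
- by rewrite size_cat !size_iota addnS.
- rewrite cat_uniq !iota_uniq andTb andbT; apply/hasPn => x.
  by rewrite !mem_iota; lia.
- by apply/allP => x; rewrite mem_cat !mem_iota/=; lia.
- by move=> s; rewrite lee_fin sqr_ge0.
- exact/measurable_EFinP.
Qed.

Let v k (y : k.+2.-tuple R) := h k r (tuple_of_seq k.+1 (forget_last k y)).

Let measurable_v k : measurable_fun setT (@v k).
Proof.
apply: (measurableT_comp (@mh k)); apply: measurable_tuple_of_seq => j.
rewrite (_ : (fun _ => _) = (fun y : k.+2.-tuple R =>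
  if (j < k)%N then nth 0 y j else if j == k then nth 0 y k.+1 else 0)).
  by case: (j < k)%N; [|case: (j == k)]; try exact: measurable_nth.
apply/funext => y; rewrite nth_rcons size_takel ?size_tuple; last by lia.
by have [jk|//] := ltnP j k; rewrite nth_take.
Qed.

Let v_prefix k s : (k.+1 < size s)%N ->
  v (tuple_of_seq k.+2 s) = h k r (tuple_of_seq k.+1 (forget_last k s)).
Proof.
move=> ks; rewrite /v /forget_last tuple_of_seq_take// take_takel; last first.
  by rewrite ltnW.
by rewrite nth_take.
Qed.

Let gain k : seq R -> R := fun s =>
  (v (tuple_of_seq k.+2 s) - h k.+1 r (tuple_of_seq k.+2 s)) ^+ 2.

Let measurable_gain N k : tuple_measurable_fun N (gain k).
Proof.
apply: measurable_funX; apply: measurable_funB.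
  exact: (measurable_comp_prefix (@measurable_v k)).
exact: (measurable_comp_prefix (@mh k.+1)).
Qed.

Let gain_ge0 k s : 0 <= gain k s. Proof. exact: sqr_ge0. Qed.

(** Pythagoras at [k.+1] points, for the prediction that ignores the last of them. The gain does not
    involve [Z], so its expectation is over [k.+2] draws only, as in [degenerate]. *)
Lemma risk_succ k : (risk Pi h r id k =
  risk Pi h r id k.+1 + Exp Pi k.+2 (fun s => (gain k s)%:E))%E.
Proof.
have -> : Exp Pi k.+2 (fun s => (gain k s)%:E) =
    Exp Pi (k.+2 + r) (fun s => (gain k s)%:E).
  rewrite -(@Exp_reindex _ Pi (k.+2 + r) _ (iota 0 k.+2)).
  - apply: eq_Exp => s sE; rewrite map_nth_iota0 ?sE ?leq_addr//.
    have ks : (k.+2 <= size s)%N by rewrite sE leq_addr.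
    by rewrite /gain -[take _ s]cats0 tuple_of_seq_cat.
  - exact: size_iota.
  - exact: iota_uniq.
  - apply/allP => x; rewrite mem_iota => /andP[_ xk] /=.
    by rewrite (leq_trans xk)// leq_addr.
  - by move=> s; rewrite lee_fin.
  - by apply/measurable_EFinP; exact: measurable_gain.
rewrite risk_forget_last.
rewrite -(cond_ecdf_pythagoras (@measurable_v k)) => [|y]; last exact: h01.
by apply: eq_Exp => s sE; rewrite v_prefix// sE leq_addr.
Qed.

(** Finiteness is what turns a positive gain into a strict inequality between extended reals. *)
Lemma risk_fin_num k : risk Pi h r id k \is a fin_num.
Proof.
pose u s := h k r (tuple_of_seq k.+1 s).
have -> : risk Pi h r id k = Exp Pi (k.+1 + r)
    (fun s => ((u s - ecdf (drop k.+1 s) (nth 0 s k)) ^+ 2)%:E).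
  by apply: eq_Exp => s sE; rewrite prediction_id// sE leq_addr.
apply: (@Exp_fin_num _ _ _ _ 1) => [s|].
  have /andP[? ?] := h01 (tuple_of_seq k.+1 s).
  have /andP[? ?] := ecdf_ge0_le1 (drop k.+1 s) (nth 0 s k).
  rewrite sqr_ge0/= /u; nra.
apply: measurable_funX; apply: measurable_funB; last exact: measurable_ecdf.
exact: (measurable_comp_prefix (@mh k)).
Qed.

Lemma risk_lt k : ~ degenerate Pi -> (risk Pi h r id k.+1 < risk Pi h r id k)%E.
Proof.
move=> ndeg; rewrite (risk_succ k) lteDl ?risk_fin_num// lt0e.
rewrite (@Exp_ge0 _ _ _ (gain k))// andbT; apply/eqP => gain0; apply: ndeg.
(* If the gain is null, these two versions agree almost surely and witness degeneracy. *)
exists k, (h k r), (h k.+1 r).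
split; first exact: (is_cond_ecdf1 r0 (@h0 k) (@cond_h k)).
split; first exact: (is_cond_ecdf1 r0 (@h0 k.+1) (@cond_h k.+1)).
have E0 := @Exp_eq0 _ Pi k.+2 (gain k) (@gain_ge0 k) (@measurable_gain _ k)
  gain0.
apply: etrans E0; apply: eq_Exp => s sE; congr EFin.
rewrite !indicE; congr (_%:R).
congr nat_of_bool; apply/idP/idP; rewrite !inE/= /gain v_prefix ?sE//;
  by rewrite sqrf_eq0 subr_eq0.
Qed.

Lemma risk_ltn k k' : ~ degenerate Pi -> (k < k')%N ->
  (risk Pi h r id k' < risk Pi h r id k)%E.
Proof.
move=> ndeg; elim: k' => // k' IH; rewrite ltnS leq_eqVlt => /predU1P[->|/IH].
  exact: risk_lt.
by apply: lt_trans; exact: risk_lt.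
Qed.

End risk_theory.

Lemma strategy_measurable_id (R : realType) :
  strategy_measurable (id : strategy R).
Proof.
move=> l l'; split; last first.
  by move=> j; apply: measurable_funTS; exact: measurable_nth.
have [->|ll'] := eqVneq l' l.
  rewrite (_ : mkset _ = setT)//.
  by apply/seteqP; split => // x _ /=; rewrite size_tuple.
rewrite (_ : mkset _ = set0)//; apply/seteqP; split => // x /=.
by rewrite size_tuple => /esym/eqP; rewrite (negbTE ll').
Qed.

(** * Reduction of the mechanism's expected loss to the risk of one agent *)

Section exp_loss_risk.
Context {R : realType} (m : nat).
Variables (n : 'I_m -> nat) (i : 'I_m).

Let ns := [seq n j | j <- enum 'I_m].
Let N0 := sumn ns.
(** Reshaping the list of positions rather than the sample presents each dataset as a selection of
    coordinates, the form that [Exp_reindex] handles. *)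
Let idx (j : nat) := nth [::] (reshape ns (iota 0 N0)) j.
Let others := flatten [seq idx (val j) | j <- enum 'I_m & j != i].

Let size_ns : size ns = m. Proof. by rewrite size_map size_enum_ord. Qed.

Let perm_idx : perm_eq (idx i ++ others) (iota 0 N0).
Proof.
have E : iota 0 N0 = flatten [seq idx (val j) | j <- enum 'I_m].
  rewrite -[LHS](@reshapeKr _ ns) ?size_iota//; congr flatten.
  have -> : [seq idx (val j) | j <- enum 'I_m] = [seq idx j | j <- iota 0 m].
    by rewrite -val_enum_ord -map_comp.
  rewrite /idx map_nth_iota0 ?size_reshape ?size_ns//.
  by rewrite take_oversize// size_reshape size_ns.
rewrite E -[idx i ++ others]/(flatten [seq idx (val j) |
  j <- i :: [seq j <- enum 'I_m | j != i]]).
apply: perm_flatten; apply: perm_map; apply: uniq_perm.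
- by rewrite /= mem_filter eqxx/= filter_uniq// enum_uniq.
- exact: enum_uniq.
- by move=> j; rewrite inE mem_filter !mem_enum andbT orbN.
Qed.

Let size_idx : size (idx i) = n i.
Proof.
have := @reshapeKl _ ns (iota 0 N0); rewrite size_iota => /(_ (leqnn _)).
move=> /(congr1 (fun sh => nth 0%N sh i)).
rewrite nth_shape => ->.
by rewrite (nth_map i) ?size_enum_ord// nth_ord_enum.
Qed.

Let size_others : size others = (\sum_(j < m | j != i) n j)%N.
Proof.
have := perm_size perm_idx; rewrite size_cat size_idx size_iota.
rewrite /N0 sumnE big_map big_enum/= (bigD1 i)//=.
by move/eqP; rewrite eqn_add2l => /eqP.
Qed.

Let block (s : seq R) (j : 'I_m) : size s = N0 ->
  nth [::] (reshape ns s) j = [seq nth 0 s l | l <- idx j].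
Proof.
move=> sE; have {1}-> : s = [seq nth 0 s l | l <- iota 0 N0].
  by rewrite map_nth_iota0 ?sE// -sE take_size.
rewrite -map_reshape (nth_map [::])//.
by rewrite size_reshape size_ns.
Qed.

Let rest (s : seq R) (f : strategy R) : size s = N0 ->
  flatten [seq deviate i f j (nth [::] (reshape ns s) j) |
    j <- enum 'I_m & j != i] = [seq nth 0 s l | l <- others].
Proof.
move=> sE; rewrite map_flatten -map_comp; congr flatten.
apply/eq_in_map => j; rewrite mem_filter => /andP[ji _] /=.
by rewrite /deviate (negbTE ji) block.
Qed.

(** The order of positions that puts agent [i]'s points first, then the one chosen as [T], then
    those of [Z], as [risk] expects. *)
Let draw p := idx i ++ nth 0%N others p :: take p others ++ drop p.+1 others.

Let perm_draw p : (p < size others)%N -> perm_eq (draw p) (iota 0 N0).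
Proof.
move=> pS; apply: perm_trans perm_idx; rewrite perm_cat2l.
rewrite -[X in perm_eq _ X](cat_take_drop p) (drop_nth 0%N pS).
by rewrite -(cat1s _ (take p others ++ _)) -(cat1s _ (drop _ _)) perm_catCA.
Qed.

(** For each choice [p] of [T], the loss is one fixed function of the sample permuted by [draw p].
    All [r.+1] choices thus have the same expectation, and so does their average. *)
Lemma exp_loss_risk (Pi : prior R) (h : forall k r : nat, k.+1.-tuple R -> R)
    (f : strategy R) (r : nat) :
  valid_h Pi h -> strategy_measurable f -> (0 < r)%N ->
  (\sum_(j < m | j != i) n j)%N = r.+1 ->
  exp_loss Pi h n (deviate i f) i = risk Pi h r f (n i).
Proof.
move=> valid mf r0 nr; have sO : size others = r.+1 by rewrite size_others.
pose loss k (s : seq R) : R :=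
  (prediction h r f k s - ecdf (drop k.+1 s) (nth 0 s k)) ^+ 2.
pose L p (s : seq R) := loss (n i) [seq nth 0 s l | l <- draw p].
have loss0 k s : 0 <= loss k s by exact: sqr_ge0.
have mloss k : tuple_measurable_fun (k.+1 + r) (loss k).
  apply: measurable_funX; apply: measurable_funB; last exact: measurable_ecdf.
  have mp := measurable_comp_prefix (N := k.+1 + r)
    (measurable_prediction valid r0 mf).
  rewrite (_ : (fun _ => _) = (fun t : (k.+1 + r).-tuple R =>
      prediction h r f k (tuple_of_seq k.+1 t))); first exact: mp.
  by apply/funext => t; rewrite prediction_prefix// size_tuple leq_addr.
have sizeD p : (p < r.+1)%N -> size (draw p) = ((n i).+1 + r)%N.
  rewrite -sO => pO; rewrite (perm_size (perm_draw pO)) -(perm_size perm_idx).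
  by rewrite size_cat size_idx sO addnS.
have LE p : (p < r.+1)%N ->
    Exp Pi N0 (fun s => (L p s)%:E) = risk Pi h r f (n i).
  move=> pr; have pO : (p < size others)%N by rewrite sO.
  rewrite /L (@Exp_reindex _ Pi N0 ((n i).+1 + r) (draw p)
    (fun s => (loss (n i) s)%:E))//.
  - exact: sizeD.
  - by rewrite (perm_uniq (perm_draw pO)) iota_uniq.
  - apply/allP => x; rewrite (perm_mem (perm_draw pO)) mem_iota.
    by rewrite add0n.
  - by move=> s; rewrite lee_fin.
  - by apply/measurable_EFinP; exact: mloss.
have L0 p s : 0 <= L p s by exact: loss0.
have mL p : (p < r.+1)%N -> tuple_measurable_fun N0 (L p).
  move=> pr; have mE : tuple_measurable_fun (size (draw p))
      (fun s => (loss (n i) s)%:E).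
    by rewrite sizeD//; apply/measurable_EFinP; exact: mloss.
  apply/measurable_EFinP.
  exact: (@tuple_measurable_reindex _ N0 _ (fun s => (loss (n i) s)%:E) mE).
(* [Exp_sum] asks for measurability at every natural index, whereas [draw p] is a permutation only
   for [p] below [r.+1]; the family is extended by 0. *)
pose L' p : seq R -> R := if (p < r.+1)%N then L p else cst 0.
have L'0 p s : 0 <= L' p s by rewrite /L'; case: ifP.
have mL' p : tuple_measurable_fun N0 (L' p).
  rewrite /L'; case: (boolP (p < r.+1)%N) => [/mL//|_].
  exact: measurable_cst.
transitivity (Exp Pi N0
    (fun s => (r.+1%:R^-1 * \sum_(p < r.+1) L' p s)%:E)).
  apply: eq_Exp => s sE; congr EFin; rewrite /mech_loss rest//.
  rewrite size_map sO/=; congr (_ * _); apply: eq_bigr => p _.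
  have pO : (p < size others)%N by rewrite sO.
  have sb : size [seq nth 0 s l | l <- idx i] = n i by rewrite size_map.
  rewrite /L' ltn_ord /L /loss /prediction map_cat take_size_cat//.
  rewrite /deviate eqxx block//.
  rewrite nth_cat sb ltnn subnn drop_cat sb ltnNge leqnSn/= subSnn/=.
  rewrite drop0 map_cat map_take map_drop (nth_map 0%N)//.
rewrite (@ExpZ _ Pi _ _ (fun s => \sum_(p < r.+1) L' p s)).
- rewrite Exp_sum//.
  rewrite (eq_bigr (fun=> risk Pi h r f (n i))); last first.
    by move=> p _; rewrite /L' ltn_ord LE.
  have fin : risk Pi h r f (n i) \is a fin_num.
    apply: (@Exp_fin_num _ _ _ (loss (n i)) 1) => // s.
    rewrite loss0/= /loss.
    have /andP[? ?] := prediction_ge0_le1 valid r0 f (n i) s.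
    have /andP[? ?] := ecdf_ge0_le1 (drop (n i).+1 s) (nth 0 s (n i)).
    nra.
  rewrite -(fineK fin) sumEFin sumr_const card_ord -EFinM.
  by rewrite -[X in _ * X]mulr_natl mulKf// pnatr_eq0.
- by rewrite invr_ge0.
- by move=> s; rewrite sumr_ge0.
- by apply: measurable_sum.
Qed.

End exp_loss_risk.


Theorem theorem1 (R : realType) (m : nat) (Pi : prior R)
    (h : forall k r : nat, k.+1.-tuple R -> R) :
  (2 <= m)%N ->
  valid_h Pi h ->
  (* (i) truthfulness is a Nash equilibrium *)
  (forall (n : 'I_m -> nat) (i : 'I_m) (f : strategy R),
      (2 <= \sum_(j < m | j != i) n j)%N ->
      strategy_measurable f ->
      (exp_loss Pi h n (fun _ => id) i <= exp_loss Pi h n (deviate i f) i)%E)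
  /\
  (* (ii) more data is strictly better, for non-degenerate priors *)
  (~ degenerate Pi ->
   forall (n : 'I_m -> nat) (i : 'I_m) (ni ni' : nat),
      (2 <= \sum_(j < m | j != i) n j)%N ->
      (ni < ni')%N ->
      (exp_loss Pi h (upd_size n i ni') (fun _ => id) i
         < exp_loss Pi h (upd_size n i ni) (fun _ => id) i)%E).
Proof.
move=> _ valid.
(* The truthful profile is the deviation of agent [i] to [id], so [exp_loss_risk] covers both
   sides. *)
have truthful (i : 'I_m) :
    (fun=> id : strategy R) = deviate i (id : strategy R).
  by apply/funext => j; rewrite /deviate if_same.
split=> [n i f n2 mf|ndeg n i k k' n2 kk'].
  (* One of the others' points serves as [T] and [r] remain for [Z]; having at least two of them
     gives [0 < r]. *)
  rewrite (truthful i); move: n2; case E: (\sum_(_ < _ | _) _)%N => [//|r] r0.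
  rewrite (exp_loss_risk valid mf r0 E).
  rewrite (exp_loss_risk valid (@strategy_measurable_id R) r0 E).
  exact: risk_truthful_le.
rewrite (truthful i); move: n2; case E: (\sum_(_ < _ | _) _)%N => [//|r] r0.
have E' l : (\sum_(j < m | j != i) upd_size n i l j)%N = r.+1.
  by rewrite -E; apply: eq_bigr => j ji; rewrite /upd_size (negbTE ji).
rewrite !(exp_loss_risk valid (@strategy_measurable_id R) r0 (E' _)).
by rewrite /upd_size eqxx; exact: risk_ltn.
Qed.
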